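(* Every $P_4$-reducible graph is GaTEx.
   Context: All graphs are finite, simple and undirected. A graph is $P_4$-reducible if every vertex belongs to at most one induced path on four vertices. A galled-tree on a finite nonempty set $X$ is a directed acyclic graph $N=(V,E)$ such that either $V=X=\{x\}$ and $E=\emptyset$, or: (N1) there is a unique root with indegree 0 and outdegree at least 2; (N2) $x\in X$ iff $x$ has outdegree 0 and indegree 1; (N3) every non-root $v\in V\setminus X$ has either indegree 1 and outdegree at least 2, or indegree 2 and outdegree at least 1 (hybrid-vertex); (N4) each biconnected component $C$ of $N$ contains at most one hybrid-vertex whose two in-neighbours both belong to $C$. For $x,y\in X$, $\mathrm{lca}_N(x,y)$ is the (unique) minimal common ancestor of $x,y$. A labeled galled-tree $(N,t)$ has $t:V\to\{0,1,\odot\}$ with $t(x)=\odot$ iff $x\in X$; it explains the graph on $X$ where $\{x,y\}$ is an edge iff $t(\mathrm{lca}_N(x,y))=1$. A graph is GaTEx if it is isomorphic to a graph explained by some labeled galled-tree. *)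

(* Defs.v *)
From mathcomp Require Import all_boot.

Set Implicit Arguments.
Unset Strict Implicit.
Unset Printing Implicit Defensive.

Section SimpleGraphs.
Variables (T : finType) (g : rel T).

(* An induced path is identified with its vertex set, which determines it. *)
Definition induced_P4 (A : {set T}) : Prop :=
  exists f : 'I_4 -> T,
    [/\ injective f, A = [set f i | i : 'I_4]
      & forall i j : 'I_4, g (f i) (f j) = (j == i.+1 :> nat) || (i == j.+1 :> nat)].

Definition P4_reducible : Prop :=
  forall (v : T) (A B : {set T}),
    induced_P4 A -> induced_P4 B -> v \in A -> v \in B -> A = B.

End SimpleGraphs.

Definition graph_iso (T T' : finType) (g : rel T) (h : rel T') : Prop :=
  exists2 f : T -> T', bijective f & forall x y, g x y = h (f x) (f y).

Section Networks.
(* [e u v] is the arc from [u] to [v]. *)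
Variables (V : finType) (e : rel V).

Definition in_nbrs (v : V) : {set V} := [set u | e u v].
Definition out_nbrs (v : V) : {set V} := [set w | e v w].
Definition indeg (v : V) : nat := #|in_nbrs v|.
Definition outdeg (v : V) : nat := #|out_nbrs v|.

Definition acyclic : Prop := forall u v : V, e u v -> ~~ connect e v u.

Definition uadj : rel V := [rel u v | e u v || e v u].

Definition connected_in (A : {set V}) : bool :=
  [forall u in A, forall v in A,
     connect [rel x y | [&& x \in A, y \in A & uadj x y]] u v].

Definition biconnected (A : {set V}) : bool :=
  connected_in A && [forall v in A, connected_in (A :\ v)].

(* Maximal biconnected subgraphs are induced, so vertex sets suffice. *)
Definition biconnected_component (C : {set V}) : bool :=
  maxset (fun A : {set V} => biconnected A) C.

Definition hybrid (v : V) : Prop := indeg v = 2 /\ 1 <= outdeg v.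

Definition galled_tree (X : {set V}) : Prop :=
  [/\ X != set0, acyclic
    & ((exists x : V, [set: V] = [set x] /\ X = [set x])
       /\ (forall u v : V, ~~ e u v))
      \/
      exists r : V,
        [/\ [/\ indeg r = 0, 2 <= outdeg r & forall v, indeg v = 0 -> v = r],
            forall x : V, x \in X <-> outdeg x = 0 /\ indeg x = 1,
            forall v : V, v \notin X -> v <> r ->
              (indeg v = 1 /\ 2 <= outdeg v) \/ hybrid v
          & forall C : {set V}, biconnected_component C ->
            forall u v : V,
              u \in C -> hybrid u -> in_nbrs u \subset C ->
              v \in C -> hybrid v -> in_nbrs v \subset C -> u = v]].

Definition common_ancestor (x y v : V) : bool := connect e v x && connect e v y.

Definition min_common_ancestor (x y v : V) : Prop :=
  common_ancestor x y v
  /\ forall w : V, common_ancestor x y w -> connect e v w -> w = v.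

Definition is_lca (x y v : V) : Prop :=
  forall w : V, min_common_ancestor x y w <-> w = v.

End Networks.

(* [Lleaf] is the label written \odot. *)
Inductive label := L0 | L1 | Lleaf.

Definition labeled_galled_tree (V : finType) (e : rel V) (X : {set V})
    (t : V -> label) : Prop :=
  galled_tree e X /\ forall v : V, t v = Lleaf <-> v \in X.

(* Since lca's of pairs of leaves of a galled-tree always exist and are unique,
   [h] is determined by [e] and [t]. *)
Definition explains (V : finType) (e : rel V) (X : {set V}) (t : V -> label)
    (h : rel {x : V | x \in X}) : Prop :=
  forall x y : {x : V | x \in X},
    exists2 v : V, is_lca e (val x) (val y) v & (h x y <-> x <> y /\ t v = L1).

Definition GaTEx (T : finType) (g : rel T) : Prop :=
  exists (V : finType) (e : rel V) (X : {set V}) (t : V -> label)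
         (h : rel {x : V | x \in X}),
    [/\ labeled_galled_tree e X t, explains e t h & graph_iso g h].

(* Main.v *)
Require Import Defs.
From mathcomp Require Import all_boot.

(** Explainability is closed under substitution: if [M] is a module with
    representative [m], a network for [M] can be hung in place of the leaf [m]
    of a network for the graph with [M] contracted to [m]. Since the two parts
    share a single cut vertex, no two galls are merged. It therefore suffices
    to explain the P4-reducible graphs without nontrivial module. A graph on
    at least three vertices without an induced P4 has a nontrivial module
    (Seinsche). If [a - b - c - d] is an induced P4, then P4-reducibility
    forces every other vertex to see all, none, or exactly [b] and [c] of the
    path; the path together with the vertices of the third kind form a module,
    as do the latter alone. So only graphs on two vertices, the P4 and the bull
    remain, and those have explicit networks with at most one gall. *)

Set Implicit Arguments.
Unset Strict Implicit.
Unset Printing Implicit Defensive.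

(** * Networks and explanations of vertex subsets *)

(** A galled-tree with more than one vertex, its leaves being the sinks. (N4) is required of every
    biconnected set, not only of maximal ones, because maximality may be lost on restricting to one
    side of a gluing. Reachability from [r] encodes the uniqueness of the root. *)
Record network (V : finType) (e : rel V) (r : V) : Prop := Network {
  net_acyclic : acyclic e;
  net_root_connect : forall v, connect e r v;
  net_root_source : forall u, ~~ e u r;
  net_root_out : 2 <= outdeg e r;
  net_degrees : forall v, v <> r ->
    [\/ outdeg e v = 0 /\ indeg e v = 1,
        indeg e v = 1 /\ 2 <= outdeg e v | hybrid e v];
  net_galls : forall C : {set V}, biconnected e C -> forall u v : V,
    u \in C -> indeg e u = 2 -> in_nbrs e u \subset C ->
    v \in C -> indeg e v = 2 -> in_nbrs e v \subset C -> u = v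
}.

(* Stronger than [is_lca]: not only is [v] the unique minimal common ancestor,
   all common ancestors lie above it. This form is stable under gluing. *)
Definition greatest_common_ancestor (V : finType) (e : rel V) (x y v : V) :=
  forall u, connect e u x && connect e u y = connect e u v.

(** Outside [S] the values of [l] are arbitrary, and so are those of [t] at leaves: the leaf label
    is restored only when passing to [GaTEx]. *)
Record explained_by (T : finType) (g : rel T) (S : {set T}) (V : finType)
    (e : rel V) (r : V) (l : T -> V) (t : pred V) : Prop := ExplainedBy {
  expl_net : network e r;
  expl_inj : {in S &, injective l};
  expl_leaves : [set l x | x in S] = [set v | outdeg e v == 0];
  expl_lca : {in S &, forall x y, x != y ->
    exists2 v, greatest_common_ancestor e (l x) (l y) v & t v = g x y}
}.

Definition explainable (T : finType) (g : rel T) (S : {set T}) : Prop :=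
  exists (V : finType) (e : rel V) (r : V) (l : T -> V) (t : pred V),
    explained_by g S e r l t.

Section Networks.
Variables (V : finType) (e : rel V).

Lemma connect_sink z v : outdeg e z = 0 -> connect e z v = (z == v).
Proof.
move/eqP; rewrite cards_eq0 => /eqP z0; apply/idP/eqP => [|->]; last exact: connect0.
case/connectP => [[|w p]] //= /andP[ezw _] _.
by have := in_set0 w; rewrite -z0 inE ezw.
Qed.

Lemma connect_source r v : (forall u, ~~ e u r) -> connect e v r = (v == r).
Proof.
move=> r0; apply/idP/eqP => [|->]; last exact: connect0.
case/connectP => p; case/lastP: p => [|p w] //=.
rewrite rcons_path last_rcons => /andP[_ ew] Er.
by have := r0 (last v p); rewrite Er ew.
Qed.

Lemma acyclic_antisym u v :
  acyclic e -> connect e u v -> connect e v u -> u = v.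
Proof.
move=> acy /connectP[[|w p]] //= /andP[euw ew] -> cv.
case/negP: (acy _ _ euw); apply: connect_trans cv.
by apply/connectP; exists p.
Qed.

Lemma greatest_common_ancestor_lca x y v :
  acyclic e -> greatest_common_ancestor e x y v -> is_lca e x y v.
Proof.
move=> acy gv w; have vxy : common_ancestor e x y v.
  by rewrite /common_ancestor gv.
split=> [[wxy wmin]|->].
  by apply/esym/wmin; rewrite // -gv.
split=> // u; rewrite /common_ancestor gv => uv vu.
exact: acyclic_antisym uv vu.
Qed.

End Networks.

(** * Biconnected sets under induced embeddings *)

Section Embedding.
Variables (V W : finType) (e : rel V) (e' : rel W) (f : V -> W).
Hypotheses (f_inj : injective f) (f_rel : forall u v, e' (f u) (f v) = e u v).

(** A walk inside [C] never leaves the image of [f], so it pulls back step by step. *)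
Lemma connected_in_preim (C : {set W}) : C \subset [set f v | v : V] ->
  connected_in e' C -> connected_in e (f @^-1: C).
Proof.
move=> /subsetP Cf /forallP Ccon; apply/forallP => u; apply/implyP.
rewrite inE => uC; apply/forallP => v; apply/implyP; rewrite inE => vC.
move: (Ccon (f u)); rewrite uC => /forallP/(_ (f v)); rewrite vC /=.
case/connectP => s; elim: s u {uC} => [|w s IH] u /=.
  by move=> _ /f_inj->; exact: connect0.
case/andP=> /and3P[uC wC uw] ws lw; have /imsetP[w' _ Ew] := Cf w wC; subst w.
apply: connect_trans (IH w' ws lw); apply: connect1.
by move: uw; rewrite /= /uadj /= !f_rel !inE uC wC.
Qed.

Lemma biconnected_preim (C : {set W}) : C \subset [set f v | v : V] ->
  biconnected e' C -> biconnected e (f @^-1: C).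
Proof.
move=> Cf /andP[Ccon /forallP Cbi]; rewrite /biconnected connected_in_preim //=.
apply/forallP => v; apply/implyP; rewrite inE => vC.
have -> : (f @^-1: C) :\ v = f @^-1: (C :\ f v).
  by apply/setP=> u; rewrite !inE (inj_eq f_inj).
apply: connected_in_preim; last by have := Cbi (f v); rewrite vC.
exact: subset_trans (subsetDl _ _) Cf.
Qed.

End Embedding.

(** * Gluing two networks at a cut vertex *)

Section Gluing.
(* The root [r'] of the second network is identified with the leaf [z] of the
   first. The result is the part of the Cartesian product lying on the two
   axes through [(z, r')], so that reachability is computed componentwise. *)
Variables (V V' : finType) (e : rel V) (e' : rel V') (r z : V) (r' : V').
Hypotheses (N : network e r) (N' : network e' r').
Hypotheses (z_leaf : outdeg e z = 0) (z_indeg : indeg e z = 1).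

Definition glue : finType := {p : V * V' | (p.1 == z) || (p.2 == r')}.

Definition glue_rel : rel glue := [rel p q |
  e (val p).1 (val q).1 && ((val p).2 == (val q).2)
  || ((val p).1 == (val q).1) && e' (val p).2 (val q).2].

Fact glue1_subproof v : ((v, r').1 == z) || ((v, r').2 == r').
Proof. by rewrite eqxx orbT. Qed.
Definition glue1 v : glue := exist _ (v, r') (glue1_subproof v).

Fact glue2_subproof w : ((z, w).1 == z) || ((z, w).2 == r').
Proof. by rewrite eqxx. Qed.
Definition glue2 w : glue := exist _ (z, w) (glue2_subproof w).

Lemma glue1_inj : injective glue1. Proof. by move=> u v []. Qed.
Lemma glue2_inj : injective glue2. Proof. by move=> u v []. Qed.

Lemma glue12 : glue1 z = glue2 r'. Proof. exact: val_inj. Qed.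

(** The shared vertex is classified as [glue2 r'], whence the side condition in the first case
    only. *)
Variant glue_spec : glue -> Prop :=
| GlueFst v of v != z : glue_spec (glue1 v)
| GlueSnd w : glue_spec (glue2 w).

Lemma glueP p : glue_spec p.
Proof.
case: (boolP ((val p).1 == z)) => [pz|pz].
  suff -> : p = glue2 (val p).2 by constructor.
  by apply: val_inj; case: p pz => [[v w] vw] /= /eqP->.
suff -> : p = glue1 (val p).1 by constructor.
apply: val_inj; case: p pz => [[v w] vw] /= /negPf nz.
by case/orP: vw => /=; rewrite ?nz // => /eqP->.
Qed.

Lemma leaf_rel v : e z v = false.
Proof.
apply/negP => ezv; move/eqP: z_leaf; rewrite cards_eq0 => /eqP z0.
by have := in_set0 v; rewrite -z0 inE ezv.
Qed.

Lemma root_rel u : e' u r' = false.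
Proof. by have /negPf := net_root_source N' u. Qed.

Lemma glue_rel11 u v : glue_rel (glue1 u) (glue1 v) = e u v.
Proof. by rewrite /glue_rel /= eqxx andbT root_rel andbF orbF. Qed.

Lemma glue_rel22 u v : glue_rel (glue2 u) (glue2 v) = e' u v.
Proof. by rewrite /glue_rel /= eqxx leaf_rel. Qed.

Lemma glue_rel12 v w : v != z -> glue_rel (glue1 v) (glue2 w) = e v z && (w == r').
Proof. by move=> /negPf vz; rewrite /glue_rel /= vz orbF [r' == w]eq_sym. Qed.

Lemma glue_rel21 v w : v != z -> glue_rel (glue2 w) (glue1 v) = false.
Proof. by move=> vz; rewrite /glue_rel /= leaf_rel [z == v]eq_sym (negPf vz). Qed.

(** Every arc moves one coordinate and fixes the other. Conversely, a path from the first axis to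
    the second can be routed through the shared vertex, and nothing leads back since [z] is a
    leaf. *)
Lemma connect_glue p q :
  connect glue_rel p q = connect e (val p).1 (val q).1 && connect e' (val p).2 (val q).2.
Proof.
have sub12 u v : connect e u v -> connect glue_rel (glue1 u) (glue1 v).
  case/connectP => s; elim: s u => [|w s IH] u /=; first by move=> _ ->; exact: connect0.
  case/andP=> euw pw lw; apply: connect_trans (IH w pw lw).
  by apply: connect1; rewrite glue_rel11.
have sub22 u v : connect e' u v -> connect glue_rel (glue2 u) (glue2 v).
  case/connectP => s; elim: s u => [|w s IH] u /=; first by move=> _ ->; exact: connect0.
  case/andP=> euw pw lw; apply: connect_trans (IH w pw lw).
  by apply: connect1; rewrite glue_rel22.
apply/idP/idP.
  case/connectP => s; elim: s p => [|w s IH] p /=.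
    by move=> _ ->; rewrite !connect0.
  case/andP=> pw ps lw; case/andP: (IH w ps lw) => c1 c2.
  by case/orP: pw => /andP[pw1 pw2]; apply/andP; split;
    rewrite ?(eqP pw1) ?(eqP pw2) //; apply: connect_trans (connect1 _) _; eauto.
case/andP; case: (glueP p) => [u uz|u]; case: (glueP q) => [v vz|v] /=.
- by move=> /sub12.
- move=> uz' rv; apply: (connect_trans (sub12 _ _ uz')); rewrite glue12; exact: sub22.
- by rewrite (connect_sink _ z_leaf) eq_sym (negPf vz).
- by move=> _ /sub22.
Qed.

(** This includes [v = z]: as [r'] is a source, the shared vertex inherits its in-arcs from the
    first network. Likewise its out-arcs all come from the second. *)
Lemma in_nbrs_glue1 v : in_nbrs glue_rel (glue1 v) = glue1 @: in_nbrs e v.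
Proof.
apply/setP=> p; rewrite inE; apply/idP/imsetP => [|[u]]; last first.
  by rewrite inE => euv ->; rewrite glue_rel11.
case: (glueP p) => [u uz|w]; first by rewrite glue_rel11 => euv; exists u; rewrite ?inE.
by rewrite /glue_rel /= leaf_rel root_rel andbF.
Qed.

Lemma in_nbrs_glue2 w : w != r' -> in_nbrs glue_rel (glue2 w) = glue2 @: in_nbrs e' w.
Proof.
move=> wr; apply/setP=> p; rewrite inE; apply/idP/imsetP => [|[u]]; last first.
  by rewrite inE => euv ->; rewrite glue_rel22.
case: (glueP p) => [u uz|u]; first by rewrite glue_rel12 // (negPf wr) andbF.
by rewrite glue_rel22 => euv; exists u; rewrite ?inE.
Qed.

Lemma out_nbrs_glue1 v : v != z -> out_nbrs glue_rel (glue1 v) = glue1 @: out_nbrs e v.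
Proof.
move=> vz; apply/setP=> p; rewrite inE; apply/idP/imsetP => [|[u]]; last first.
  by rewrite inE => euv ->; rewrite glue_rel11.
case: (glueP p) => [u uz|u]; first by rewrite glue_rel11 => euv; exists u; rewrite ?inE.
rewrite glue_rel12 // => /andP[evz /eqP->]; exists z; rewrite ?inE //.
by rewrite glue12.
Qed.

Lemma out_nbrs_glue2 w : out_nbrs glue_rel (glue2 w) = glue2 @: out_nbrs e' w.
Proof.
apply/setP=> p; rewrite inE; apply/idP/imsetP => [|[u]]; last first.
  by rewrite inE => euv ->; rewrite glue_rel22.
case: (glueP p) => [u uz|u]; first by rewrite glue_rel21.
by rewrite glue_rel22 => euv; exists u; rewrite ?inE.
Qed.

Lemma indeg_glue1 v : indeg glue_rel (glue1 v) = indeg e v.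
Proof. by rewrite /indeg in_nbrs_glue1 card_imset //; exact: glue1_inj. Qed.

Lemma indeg_glue2 w : w != r' -> indeg glue_rel (glue2 w) = indeg e' w.
Proof. by move=> wr; rewrite /indeg in_nbrs_glue2 // card_imset //; exact: glue2_inj. Qed.

Lemma outdeg_glue1 v : v != z -> outdeg glue_rel (glue1 v) = outdeg e v.
Proof. by move=> vz; rewrite /outdeg out_nbrs_glue1 // card_imset //; exact: glue1_inj. Qed.

Lemma outdeg_glue2 w : outdeg glue_rel (glue2 w) = outdeg e' w.
Proof. by rewrite /outdeg out_nbrs_glue2 card_imset //; exact: glue2_inj. Qed.

(** The shared vertex separates the two axes, so a biconnected set cannot contain further vertices
    of both. *)
Lemma biconnected_glue (C : {set glue}) : biconnected glue_rel C ->
  C \subset [set glue1 v | v : V] \/ C \subset [set glue2 w | w : V'].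
Proof.
case/andP=> Ccon /forallP Cbi.
case: (boolP (C \subset [set glue1 v | v : V])) => [|/subsetPn[p pC pN]]; [by left|right].
apply/subsetP => q qC; apply/imsetP.
case: (glueP q) qC => [u uz|w] qC; last by exists w.
case: (glueP p) pC pN => [v vz|w] pC pN; first by rewrite imset_f in pN.
have wr : w != r' by apply: contraNneq pN => ->; rewrite -glue12 imset_f.
pose c := glue2 r'.
(* If [c] is not in [C], deleting it changes nothing and connectedness of [C] itself is used. *)
have : connected_in glue_rel (C :\ c).
  have := Cbi c; case: (boolP (c \in C)) => //= cC _.
  suff -> : C :\ c = C by [].
  by apply/setDidPl; rewrite disjoint_sym disjoints1.
move/forallP/(_ (glue1 u))/implyP => /(_ _)/forallP.
have uC : glue1 u \in C :\ c.
  by rewrite !inE qC andbT /c -glue12 (inj_eq glue1_inj).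
have wC : glue2 w \in C :\ c by rewrite !inE pC andbT /c (inj_eq glue2_inj).
move/(_ uC (glue2 w))/implyP/(_ wC).
set R := [rel x y | _].
(* The only arcs between the two axes end at [c]; with [c] deleted, the first axis is closed under
   adjacency. *)
have clR : closed R [pred p : glue | (val p).1 != z].
  apply: intro_closed => [|x y].
    by apply: sym_connect_sym => x y; rewrite /R /uadj /= andbCA orbC.
  case: (glueP x) => [x' xz|x'] Rxy; last by rewrite inE /= eqxx.
  case: (glueP y) Rxy => [y' yz|y'] //; rewrite inE /= => /and3P[_].
  rewrite 2!inE => /andP[yc _] /orP[]; last by rewrite glue_rel21.
  by rewrite glue_rel12 // => /andP[_ /eqP yr]; rewrite yr eqxx in yc.
move=> cn; have := closed_connect clR cn; by rewrite !inE /= uz eqxx.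
Qed.

Lemma glue1_cases p : p <> glue1 r ->
  (exists v, [/\ p = glue1 v, v <> r & v != z])
  \/ (exists2 w, p = glue2 w & w != r') \/ p = glue1 z.
Proof.
case: (glueP p) => [v vz vr|w _].
  by left; exists v; split=> // E; apply: vr; rewrite E.
by right; case: (eqVneq w r') => [->|wr]; [right; rewrite glue12|left; exists w].
Qed.

Lemma network_glue : network glue_rel (glue1 r).
Proof.
have rz : r != z.
  by apply/eqP => rz; have := net_root_out N; rewrite rz z_leaf.
split.
- move=> p q; rewrite connect_glue negb_and => /orP[] /andP[epq epq'].
    by rewrite (net_acyclic N epq).
  by rewrite (net_acyclic N' epq') orbT.
- by move=> p; rewrite connect_glue /= (net_root_connect N) (net_root_connect N').
- move=> p; case: (glueP p) => [u uz|u].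
    by rewrite glue_rel11 (net_root_source N).
  by rewrite glue_rel21.
- by rewrite outdeg_glue1 // (net_root_out N).
- move=> p /glue1_cases[[v [-> vr vz]]|[[w -> wr]|->]].
  + by have := net_degrees N vr; rewrite /hybrid indeg_glue1 outdeg_glue1.
  + have := @net_degrees _ _ _ N' w; rewrite /hybrid indeg_glue2 // outdeg_glue2.
    by apply; exact/eqP.
  (* The shared vertex has the single in-arc of [z] and the out-arcs of [r']: it is an ordinary tree
     vertex. *)
  + by constructor 2; rewrite indeg_glue1 z_indeg glue12 outdeg_glue2 (net_root_out N').
- move=> C Cbi p q pC p2 pN qC q2 qN; case: (biconnected_glue Cbi) => /[dup] CS /subsetP Cs.
    have /imsetP[u _ Eu] := Cs p pC; move: pC p2 pN; rewrite Eu => uC.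
    rewrite indeg_glue1 in_nbrs_glue1 => u2 uN.
    have /imsetP[v _ Ev] := Cs q qC; move: qC q2 qN; rewrite Ev => vC.
    rewrite indeg_glue1 in_nbrs_glue1 => v2 vN.
    congr glue1; apply: (net_galls N (biconnected_preim glue1_inj glue_rel11 CS Cbi));
      by rewrite ?inE // -sub_imset_pre.
(* On the second side, a vertex of indegree 2 is not the shared one, so its in-neighbours are those
   in the second network. *)
have nz w : glue2 w \in C -> indeg glue_rel (glue2 w) = 2 -> w != r'.
  move=> _ w2; apply/eqP => E; move: w2; by rewrite E -glue12 indeg_glue1 z_indeg.
have /imsetP[u _ Eu] := Cs p pC; move: pC p2 pN; rewrite Eu => uC /[dup] /(nz _ uC) ur.
rewrite indeg_glue2 // in_nbrs_glue2 // => u2 uN.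
have /imsetP[v _ Ev] := Cs q qC; move: qC q2 qN; rewrite Ev => vC /[dup] /(nz _ vC) vr.
rewrite indeg_glue2 // in_nbrs_glue2 // => v2 vN.
congr glue2; apply: (net_galls N' (biconnected_preim glue2_inj glue_rel22 CS Cbi));
  by rewrite ?inE // -sub_imset_pre.
Qed.

End Gluing.

(** * Substituting a network for a module *)

Lemma network_leaf_indeg (V : finType) (e : rel V) r v :
  network e r -> outdeg e v = 0 -> indeg e v = 1.
Proof.
move=> N v0; have vr : v <> r by move=> E; have := net_root_out N; rewrite -E v0.
by case: (net_degrees N vr) => [[]|[_]|[_]] //; rewrite v0.
Qed.

Section Explained.
Variables (T : finType) (g : rel T) (S : {set T}) (V : finType) (e : rel V).
Variables (r : V) (l : T -> V) (t : pred V).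
Hypothesis E : explained_by g S e r l t.

Lemma explained_leaf x : x \in S -> outdeg e (l x) = 0.
Proof.
move=> xS; have : l x \in [set l x | x in S] by exact: imset_f.
by rewrite (expl_leaves E) inE => /eqP.
Qed.

(** A leaf reaches only itself, so it cannot lie above two distinct leaves. Hence the relabeling of
    leaves, or of the leaf used for gluing, never affects a relevant label. *)
Lemma greatest_common_ancestor_not_leaf x y z v : x \in S -> y \in S -> x != y ->
  greatest_common_ancestor e (l x) (l y) v -> z \in S -> v != l z.
Proof.
move=> xS yS xy gv zS; apply: contraNneq xy => vz.
have := gv v; rewrite connect0 vz !(connect_sink _ (explained_leaf zS)).
by case/andP=> /eqP/(expl_inj E) <- // /eqP/(expl_inj E) <-.
Qed.

End Explained.

Section Substitution.
Variables (T : finType) (g : rel T).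
Hypothesis g_sym : symmetric g.

(** Two vertices of [M] meet inside the network of [M]. Any other pair meets where it did in the
    first network, with a member of [M] replaced by [m]; the module property makes the label found
    there correct. *)
Lemma explainable_subst (S M : {set T}) m : M \subset S -> m \in M ->
  (forall x y, x \in M -> y \in S :\: M -> g x y = g m y) ->
  explainable g (m |: (S :\: M)) -> explainable g M -> explainable g S.
Proof.
move=> /subsetP MS mM gM [V [e [r [l [t E]]]]] [V' [e' [r' [l' [t' E']]]]].
pose z := l m; set H := m |: _ in E.
have mH : m \in H by rewrite !inE eqxx.
have N := expl_net E; have N' := expl_net E'.
have z0 : outdeg e z = 0 := explained_leaf E mH.
have z1 : indeg e z = 1 := network_leaf_indeg N z0.
have SH x : x \in S -> x \notin M -> x \in H by rewrite !inE => -> ->; rewrite orbT.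
have lz x : x \in S -> x \notin M -> l x != z.
  by move=> xS xM; apply: (contraNneq _ xM) => /(expl_inj E (SH x xS xM) mH) ->.
pose L x : glue z r' := if x \in M then glue2 z r' (l' x) else glue1 z r' (l x).
exists (glue z r'), (glue_rel e e' (z := z) (r' := r')), (glue1 z r' r), L.
(* The shared vertex is an inner vertex now and takes its label from the root of the second
   network. *)
exists (fun p => if (val p).1 == z then t' (val p).2 else t (val p).1).
split.
- exact: network_glue.
- move=> x y xS yS; rewrite /L; case: ifPn => xM; case: ifPn => yM.
  + by move=> [] /(expl_inj E'); apply.
  + by move=> [] lE; have := lz y yS yM; rewrite -lE eqxx.
  + by move=> [] lE; have := lz x xS xM; rewrite -lE eqxx.
  + by move=> [] /(expl_inj E); apply; apply: SH.
- apply/setP=> p; rewrite inE; apply/imsetP/idP => [[x xS ->]|].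
    rewrite /L; case: ifPn => xM.
      by rewrite outdeg_glue2 // (explained_leaf E').
    by rewrite outdeg_glue1 ?lz // (explained_leaf E) // SH.
  case: (glueP p) => [v vz|w].
    rewrite outdeg_glue1 // => v0.
    have : v \in [set l x | x in H] by rewrite (expl_leaves E) inE.
    case/imsetP=> x; rewrite !inE => /orP[/eqP->|/andP[xM xS]] vE.
      by rewrite vE eqxx in vz.
    by exists x => //; rewrite /L (negPf xM) vE.
  rewrite outdeg_glue2 // => w0.
  have : w \in [set l' x | x in M] by rewrite (expl_leaves E') inE.
  by case/imsetP=> x xM ->; exists x; rewrite ?MS // /L xM.
have gca p q c v w : val c = (v, w) ->
    greatest_common_ancestor e (val p).1 (val q).1 v ->
    greatest_common_ancestor e' (val p).2 (val q).2 w ->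
    greatest_common_ancestor (glue_rel e e' (z := z) (r' := r')) p q c.
  move=> Ec g1 g2 u; rewrite !(connect_glue N') // Ec /= -g1 -g2.
  by rewrite andbACA.
(* Vertices of the first side have second coordinate [r'], and the root is the greatest common
   ancestor of itself and any vertex. *)
have rgca u : greatest_common_ancestor e' u r' r'.
  move=> v; rewrite (connect_source _ (net_root_source N')).
  by case: eqP => [->|_]; rewrite ?andbF // (net_root_connect N').
have gcaC (W : finType) (f : rel W) a b c :
    greatest_common_ancestor f a b c -> greatest_common_ancestor f b a c.
  by move=> h u; rewrite andbC h.
have gcaI (W : finType) (f : rel W) a : greatest_common_ancestor f a a a.
  by move=> u; rewrite andbb.
have mixed x y : x \in M -> y \in S -> y \notin M ->
    exists2 c, greatest_common_ancestor (glue_rel e e' (z := z) (r' := r')) (L x) (L y) c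
      & (if (val c).1 == z then t' (val c).2 else t (val c).1) = g x y.
  move=> xM yS yM; have yH := SH y yS yM.
  have my : m != y by apply: contraNneq yM => <-.
  have [v gv tv] := expl_lca E mH yH my; exists (glue1 z r' v).
    by rewrite /L xM (negPf yM); apply: (gca _ _ _ v r').
  rewrite /= (negPf (greatest_common_ancestor_not_leaf E mH yH my gv mH)) tv.
  by rewrite (gM x) // inE yM.
move=> x y xS yS xy; case: (boolP (x \in M)) => xM; case: (boolP (y \in M)) => yM.
- have [w gw tw] := expl_lca E' xM yM xy; exists (glue2 z r' w).
    by rewrite /L xM yM; apply: (gca _ _ _ z w).
  by rewrite /= eqxx.
- exact: mixed.
- have [c gc tc] := mixed y x yM xS xM; exists c; first exact: gcaC.
  by rewrite tc g_sym.
- have xH := SH x xS xM; have yH := SH y yS yM.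
  have [v gv tv] := expl_lca E xH yH xy; exists (glue1 z r' v).
    by rewrite /L (negPf xM) (negPf yM); apply: (gca _ _ _ v r').
  by rewrite /= (negPf (greatest_common_ancestor_not_leaf E xH yH xy gv mH)).
Qed.

End Substitution.

(** * Explicit networks checked by computation *)

Lemma all_iotaP (P : pred nat) m : reflect (forall i : 'I_m, P i) (all P (iota 0 m)).
Proof.
apply: (iffP allP) => [h i|h i]; first by apply: h; rewrite mem_iota /=.
by rewrite mem_iota /= => im; apply: (h (Ordinal im)).
Qed.

Lemma has_iotaP (P : pred nat) m : reflect (exists i : 'I_m, P i) (has P (iota 0 m)).
Proof.
apply: (iffP hasP) => [[i]|[i Pi]]; last by exists (val i); rewrite ?mem_iota /=.
by rewrite mem_iota /= => im Pi; exists (Ordinal im).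
Qed.

Lemma card_ord_count (P : pred nat) m : #|[set i : 'I_m | P i]| = count P (iota 0 m).
Proof. by rewrite cardsE cardE /enum_mem size_filter -enumT -val_enum_ord count_map. Qed.

Section ConcreteNetworks.
(* A network on [0 .. n] with arcs [arc], all decreasing, root [n], leaves the
   [k] least vertices and labels [lab], explaining [adj] on its leaves. *)
Variables (n k : nat) (arc : rel nat) (lab : pred nat) (adj : rel nat).

(* A filter rather than a conjunction keeps [vm_compute], which is strict, from
   exploring the non-arcs. *)
Fixpoint reach (fuel u v : nat) : bool :=
  if fuel is fuel'.+1 then
    (u == v) || has (fun w => reach fuel' w v) [seq w <- iota 0 n.+1 | arc u w]
  else false.

Let D := reach n.+2.
Local Notation I := (iota 0 n.+1).
Let ins v := count (fun u => arc u v) I.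
Let outs v := count (arc v) I.

(** The second conjunct checks the recursive equation of reachability for [D]. As arcs decrease,
    this equation determines [D], so the choice of fuel needs no separate justification. The sixth
    conjunct allows at most one vertex of indegree 2 in all, which implies (N4). *)
Definition concrete_network : bool :=
  [&& all (fun u => all (fun v => arc u v ==> (v < u)) I) I,
      all (fun u => all (fun v =>
        D u v == (u == v) || has (fun w => arc u w && D w v) I) I) I,
      all (D n) I,
      2 <= outs n,
      all (fun v => [|| (outs v == 0) && (ins v == 1),
        (ins v == 1) && (2 <= outs v) | (ins v == 2) && (1 <= outs v)]) (iota 0 n),
      all (fun u => all (fun v => (ins u == 2) ==> (ins v == 2) ==> (u == v)) I) I,
      k <= n.+1,
      all (fun v => (outs v == 0) == (v < k)) I &
      all (fun i => all (fun j => (i != j) ==> has (fun v =>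
        all (fun u => D u i && D u j == D u v) I && (lab v == adj i j)) I)
        (iota 0 k)) (iota 0 k)].

Lemma concrete_explainable (T : finType) (g : rel T) (x0 : T) (s : seq T) :
  concrete_network -> uniq s -> size s = k ->
  (forall i j, i < k -> j < k -> i != j -> g (nth x0 s i) (nth x0 s j) = adj i j) ->
  explainable g [set x in s].
Proof.
case/and5P=> /all_iotaP dec /all_iotaP reachE /all_iotaP rootD root_out.
case/and5P=> /all_iotaP deg /all_iotaP gall kn /all_iotaP leaf /all_iotaP lca s_uniq sk gE.
pose e : rel 'I_n.+1 := fun u v => arc u v.
have eD (u v : 'I_n.+1) : e u v -> v < u.
  by move/all_iotaP: (dec u) => /(_ v)/implyP.
(* Induction on [u] along decreasing arcs, unfolding the checked equation for [D]. *)
have connectE (u v : 'I_n.+1) : connect e u v = D u v.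
  have [m] := ubnP (val u); elim: m u => // m IH u um.
  move/all_iotaP: (reachE u) => /(_ v)/eqP->.
  apply/idP/orP => [|[/eqP/val_inj->|/has_iotaP[w /andP[euw wv]]]]; last 2 first.
  - exact: connect0.
  - apply: (connect_trans (connect1 (euw : e u w))).
    by rewrite IH //; apply: leq_trans (eD _ _ euw) _.
  case/connectP=> [[|w p]]; first by move=> _ ->; left.
  case/andP=> euw wp lw; right; apply/has_iotaP; exists w.
  rewrite [arc u w]euw -IH /=; last by apply: leq_trans (eD _ _ euw) _.
  by apply/connectP; exists p.
have insE v : indeg e v = ins v := card_ord_count (fun u => arc u v) n.+1.
have outsE v : outdeg e v = outs v := card_ord_count (arc v) n.+1.
have connect_dec (u v : 'I_n.+1) : connect e u v -> v <= u.
  case/connectP=> p; elim: p u => [|w p IH] u /=; first by move=> _ ->.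
  by case/andP=> /eD wu wp lw; apply: leq_trans (IH w wp lw) (ltnW wu).
have idx x : x \in s -> (inord (index x s) : 'I_n.+1) = index x s :> nat.
  by move=> xs; rewrite inordK //; apply: leq_trans kn; rewrite -sk index_mem.
(* The entry of [s] at position [i] becomes the leaf [i]. *)
exists 'I_n.+1, e, ord_max, (fun x => inord (index x s)), (fun v => lab (val v)).
split.
- split.
  + move=> u v /eD uv; apply/negP => /connect_dec; by rewrite leqNgt uv.
  + by move=> v; rewrite connectE.
  + by move=> u; apply/negP => /eD; rewrite ltnNge -ltnS ltn_ord.
  + by rewrite outsE.
  + move=> v vr; have vn : v < n.
      rewrite ltn_neqAle -ltnS ltn_ord andbT.
      by apply: contra_notN vr => /eqP vn; apply: val_inj.
    rewrite /hybrid outsE insE; case/or3P: (deg (Ordinal vn)) => /andP[/= h1 h2].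
    * by constructor 1; split; apply/eqP.
    * by constructor 2; split=> //; apply/eqP.
    * by constructor 3; split=> //; apply/eqP.
  + move=> C _ u v _ u2 _ _ v2 _; apply/val_inj/eqP.
    by move/all_iotaP: (gall u) => /(_ v); rewrite -!insE u2 v2.
- move=> x y; rewrite !inE => xs ys /(congr1 (@nat_of_ord _)); rewrite !idx // => xy.
  by rewrite -(nth_index x0 xs) xy nth_index.
- apply/setP=> v; rewrite inE outsE (eqP (leaf v)); apply/imsetP/idP => [[x]|vk].
    by rewrite inE => xs ->; rewrite idx // -sk index_mem.
  exists (nth x0 s v); first by rewrite inE mem_nth // sk.
  by apply: ord_inj; rewrite idx ?mem_nth ?sk // index_uniq // sk.
- move=> x y; rewrite !inE => xs ys xy.
  have xk : index x s < k by rewrite -sk index_mem.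
  have yk : index y s < k by rewrite -sk index_mem.
  have ij : index x s != index y s.
    by apply: contraNneq xy => ij; rewrite -(nth_index x0 xs) ij nth_index.
  move/all_iotaP: (lca (Ordinal xk)) => /(_ (Ordinal yk))/implyP/(_ ij).
  case/has_iotaP=> v /andP[/all_iotaP vD /eqP vl]; exists v; last first.
    by rewrite vl -gE // !nth_index.
  by move=> u; rewrite !connectE !idx //; apply/eqP/(vD u).
Qed.

End ConcreteNetworks.

Definition arcs_of (A : seq (nat * nat)) : rel nat := fun u v => (u, v) \in A.

(* The path is [0 - 1 - 2 - 3] and [4] is the hybrid vertex, above the leaf [1]. *)
Lemma concrete_P4 : concrete_network 8 4
  (arcs_of [:: (4, 1); (5, 0); (5, 4); (6, 3); (6, 4); (7, 2); (7, 6); (8, 5); (8, 7)])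
  (mem [:: 5; 7]) (fun i j => (j == i.+1) || (i == j.+1)).
Proof. by vm_compute. Qed.

(* The path is [0 - 1 - 2 - 3], the apex is [4], and [5] is the hybrid vertex, above
   the leaf [1]. *)
Lemma concrete_bull : concrete_network 10 5
  (arcs_of [:: (5, 1); (6, 0); (6, 5); (7, 4); (7, 5); (8, 3); (8, 7);
               (9, 2); (9, 8); (10, 6); (10, 9)])
  (mem [:: 6; 7; 9])
  (fun i j => ((i, j) \in [:: (0, 1); (1, 2); (2, 3); (1, 4); (2, 4)])
           || ((j, i) \in [:: (0, 1); (1, 2); (2, 3); (1, 4); (2, 4)])).
Proof. by vm_compute. Qed.

Lemma concrete_pair b : concrete_network 2 2 (arcs_of [:: (2, 0); (2, 1)])
  (fun _ => b) (fun _ _ => b).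
Proof. by case: b; vm_compute. Qed.

(** * Induced paths and Seinsche's theorem *)

Section Graph.
Variables (T : finType) (g : rel T).
Hypotheses (g_sym : symmetric g) (g_irr : irreflexive g).

Definition p4 a b c d :=
  [&& g a b, g b c, g c d, ~~ g a c, ~~ g a d & ~~ g b d].

(** Adjacent vertices differ by irreflexivity; two nonadjacent ones are told apart by a third vertex
    of the path. *)
Lemma p4_uniq a b c d : p4 a b c d -> uniq [:: a; b; c; d].
Proof.
case/and5P=> ab bc cd ac /andP[ad bd]; rewrite /= !inE !negb_or !andbT.
apply/and3P; split; [apply/and3P; split|apply/andP; split|].
- by apply: contraTneq ab => ->; rewrite g_irr.
- by apply: contraNneq ad => ->.
- by apply: contraNneq ac => ->; rewrite g_sym.
- by apply: contraTneq bc => ->; rewrite g_irr.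
- by apply: contraNneq ad => <-.
- by apply: contraTneq cd => ->; rewrite g_irr.
Qed.

Lemma p4_induced a b c d : p4 a b c d -> induced_P4 g [set x in [:: a; b; c; d]].
Proof.
move=> P; have U := p4_uniq P; set s := [:: _; _; _; _] in U *.
exists (fun i : 'I_4 => nth a s i); split.
- move=> i j /eqP; rewrite nth_uniq // => /eqP; exact: val_inj.
- apply/setP=> x; rewrite inE; apply/idP/imsetP => [xs|[i _ ->]]; last exact: mem_nth.
  have xi : index x s < 4 by rewrite (index_mem x s).
  by exists (Ordinal xi) => //=; rewrite nth_index.
case/and5P: P => ab bc cd /negPf ac /andP[/negPf ad /negPf bd].
move=> [i Hi] [j Hj] /=.
by case: i Hi => [|[|[|[|]]]] //; case: j Hj => [|[|[|[|]]]] //= _ _;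
   rewrite ?g_irr ?ab ?bc ?cd ?ac ?ad ?bd // g_sym ?ab ?bc ?cd ?ac ?ad ?bd.
Qed.

(* Seinsche's theorem, for the subgraph induced by [A]. *)
Lemma p4_free_split (A : {set T}) : 1 < #|A| ->
  (forall a b c d, a \in A -> b \in A -> c \in A -> d \in A -> ~~ p4 a b c d) ->
  exists B : {set T}, [/\ B \proper A, B != set0
    & exists k, forall x y, x \in B -> y \in A :\: B -> g x y = k].
Proof.
have [n] := ubnP #|A|; elim: n A => // n IH A An A2 free.
have [v vA] : exists v, v \in A by apply/card_gt0P; exact: ltnW A2.
have cA : #|A| = #|A :\ v|.+1 by rewrite (cardsD1 v) vA.
have vproper : [set v] \proper A by rewrite properEcard sub1set vA cards1.
have v0 : [set v] != set0 by apply/set0Pn; exists v; rewrite inE.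
case: (ltngtP #|A :\ v| 1) => [|A'2|A'1]; first by rewrite ltnNge -ltnS -cA A2.
  have [||B [BA B0 [k Bk]]] := IH (A :\ v) _ A'2.
  - by rewrite -ltnS -cA.
  - by move=> a b c d /setD1P[_ ?] /setD1P[_ ?] /setD1P[_ ?] /setD1P[_ ?]; exact: free.
  case/properP: BA => /subsetP BA [y0 y0A y0B].
  have BA1 x : x \in B -> x != v /\ x \in A by move/BA/setD1P.
  (* Here [P] and [Q] are the two sides of the split of [A :\ v], in either order. The vertices of
     [P] joined to [v] with value [k] split off from all of [A]. Keeping [k] arbitrary treats the
     graph and its complement at once. *)
  have key (P Q : {set T}) : P :|: Q = A :\ v ->
      (forall x y, x \in P -> y \in Q -> g x y = k) ->
      (exists2 u, u \in P & g v u = k) -> (exists2 q, q \in Q & g v q = ~~ k) ->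
      exists B : {set T}, [/\ B \proper A, B != set0
        & exists k, forall x y, x \in B -> y \in A :\: B -> g x y = k].
    move=> PQ PQk [u uP vu] [q qQ vq].
    have PA x : x \in P -> x \in A.
      by move=> xP; have : x \in A :\ v; [rewrite -PQ inE xP|case/setD1P].
    have qA : q \in A by have : q \in A :\ v; [rewrite -PQ inE qQ orbT|case/setD1P].
    pose U := [set x in P | g v x == k].
    have UA : U \proper A.
      apply/properP; split; first by apply/subsetP=> x; rewrite inE => /andP[/PA].
      by exists q => //; rewrite inE vq; case: (k); rewrite andbF.
    exists U; split=> //; first by apply/set0Pn; exists u; rewrite inE uP vu eqxx.
    exists k => x y; rewrite !inE => /andP[xP /eqP vx] /andP[yU yA].
    case: (eqVneq y v) => [->|yv]; first by rewrite g_sym.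
    have : y \in P :|: Q by rewrite PQ !inE yv.
    rewrite inE => /orP[yP|]; last exact: PQk.
    rewrite yP /= in yU; case: (eqVneq (g x y) k) => // xy; exfalso.
    have xq := PQk x q xP qQ; have yq := PQk y q yP qQ.
    (* A bad pair [x], [y] yields the induced path [v - x - q - y] if [k] holds, and [x - y - v - q]
       otherwise. *)
    case: (k) vx vq yU xy xq yq => vx vq; rewrite ?eqb_id ?eqbF_neg ?negbK => vy xy xq yq.
      case/negP: (free v x q y vA (PA _ xP) qA (PA _ yP)).
      by rewrite /p4 vx xq (g_sym q) yq vq vy xy.
    case/negP: (free x y v q (PA _ xP) (PA _ yP) vA qA).
    by rewrite /p4 xy (g_sym y) vy vq (g_sym x v) vx xq yq.
  pose Q := A :\ v :\: B.
  have BQ : B :|: Q = A :\ v by rewrite -[RHS](setID _ B) (setIidPr _) //; exact/subsetP.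
  case: (boolP [forall x in A :\ v, g v x == ~~ k]) => [/forall_inP all_v|].
    exists [set v]; split=> //; exists (~~ k) => x y; rewrite inE => /eqP->.
    by rewrite 2!inE => /andP[yv yA]; apply/eqP/all_v; rewrite !inE yv.
  case/forall_inPn=> u uA vu; have {}vu : g v u = k by case: (g v u) (k) vu => [] [].
  case: (boolP [forall x in B, g v x == k]) => [/forall_inP all_B|].
    exists B; split=> //.
      apply/properP; split; first by apply/subsetP=> x /BA1[].
      by exists y0 => //; case/setD1P: y0A.
    exists k => x y xB; case/setDP=> yA yB; case: (eqVneq y v) => [->|yv].
      by rewrite g_sym; apply/eqP/all_B.
    by apply: Bk; rewrite // !inE yB yv.
  case/forall_inPn=> p pB vp; have {}vp : g v p = ~~ k by case: (g v p) (k) vp => [] [].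
  case: (boolP [forall x in Q, g v x == k]) => [/forall_inP all_Q|].
    exists Q; split.
    - apply/properP; split; first by apply/subsetP=> x; rewrite !inE => /and3P[].
      by exists v => //; rewrite !inE eqxx andbF.
    - by apply/set0Pn; exists y0; rewrite inE y0B.
    exists k => x y xQ; case/setDP=> yA yQ; case: (eqVneq y v) => [->|yv].
      by rewrite g_sym; apply/eqP/all_Q.
    rewrite g_sym; apply: Bk => //; apply: contraNT yQ => yB.
    by rewrite !inE yB yv.
  case/forall_inPn=> q qQ vq; have {}vq : g v q = ~~ k by case: (g v q) (k) vq => [] [].
  (* Both sides now contain a vertex joined to [v] with value [~~ k], so [key] applies with the side
     of [u] in the role of [P]. *)
  have : u \in B :|: Q by rewrite BQ.
  rewrite inE => /orP[uB|uQ].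
    by apply: (key B Q) => //; [exists u|exists q].
  apply: (key Q B) => //; [by rewrite setUC|move=> x y xQ yB|by exists u|by exists p].
  by rewrite g_sym; apply: Bk.
have [u Au] : exists u, A :\ v = [set u] by apply/cards1P; rewrite A'1.
exists [set v]; split=> //; exists (g v u) => x y; rewrite inE => /eqP->.
by rewrite Au inE => /eqP->.
Qed.

(** * Explaining the P4-reducible graphs *)

Hypothesis g_red : P4_reducible g.

Lemma p4_same a b c d a' b' c' d' x y : p4 a b c d -> p4 a' b' c' d' ->
  x \in [:: a; b; c; d] -> x \in [:: a'; b'; c'; d'] ->
  y \in [:: a'; b'; c'; d'] -> y \in [:: a; b; c; d].
Proof.
move=> /p4_induced P /p4_induced P' xs xs' ys'.
have E : [set x in [:: a; b; c; d]] = [set x in [:: a'; b'; c'; d']].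
  by apply: (g_red (v := x)) => //; rewrite inE.
by have : y \in [set x in [:: a'; b'; c'; d']]; [rewrite inE|rewrite -E inE].
Qed.

(** Each of the other adjacency patterns creates an induced path through [v] and three vertices of
    the given one. Sharing a vertex with it, that path would have the same vertex set, although [v]
    is outside. The eight instances of [kill] cover all such patterns. *)
Lemma p4_attach a b c d v : p4 a b c d -> v \notin [:: a; b; c; d] ->
  [/\ g v d = g v a, g v c = g v b & g v a -> g v b].
Proof.
move=> P vs; have no p q r t x : p4 p q r t -> x \in [:: a; b; c; d] ->
    x \in [:: p; q; r; t] -> v \in [:: p; q; r; t] -> False.
  by move=> P' xs xs' vs'; case/negP: vs; apply: p4_same P P' xs xs' vs'.
have aP : a \in [:: a; b; c; d] by rewrite !inE eqxx.
have cP : c \in [:: a; b; c; d] by rewrite !inE eqxx ?orbT.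
have bP : b \in [:: a; b; c; d] by rewrite !inE eqxx ?orbT.
case/and5P: P => ab bc cd /negPf ac /andP[/negPf ad /negPf bd].
have [ba cb dc ca] : [/\ g b a, g c b, g d c & g c a = false].
  by split; rewrite g_sym.
have [da db] : g d a = false /\ g d b = false by split; rewrite g_sym.
have [av bv cv dv] : [/\ g a v = g v a, g b v = g v b, g c v = g v c & g d v = g v d].
  by split; rewrite g_sym.
pose E := (ab, bc, cd, ac, ad, bd, (ba, cb, dc, ca, da, db, (av, bv, cv, dv))).
have kill p q r t : p4 p q r t -> v \in [:: p; q; r; t] ->
    (a \in [:: p; q; r; t]) || (b \in [:: p; q; r; t]) || (c \in [:: p; q; r; t]) -> False.
  by move=> P' vs' /orP[/orP[]|] xs';
    [apply: no P' aP _ _|apply: no P' bP _ _|apply: no P' cP _ _].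
have := kill v a b c; have := kill v b c d; have := kill v c b a.
have := kill v d c b; have := kill a v c d; have := kill d v b a.
have := kill a v d c; have := kill d v a b.
rewrite /p4 !E !inE !eqxx ?orbT /=.
case: (g v a); case: (g v b); case: (g v c); case: (g v d) => //= k1 k2 k3 k4 k5 k6 k7 k8;
  by exfalso; auto.
Qed.

Lemma pair_explainable a b : a != b -> explainable g [set a; b].
Proof.
move=> ab; have -> : [set a; b] = [set x in [:: a; b]].
  by apply/setP=> x; rewrite !inE.
apply: (concrete_explainable (x0 := a) (concrete_pair (g a b))) => //=.
  by rewrite inE ab.
by move=> [|[|i]] [|[|j]] //= _ _ _; rewrite g_sym.
Qed.

Lemma p4_explainable a b c d : p4 a b c d -> explainable g [set x in [:: a; b; c; d]].
Proof.
move=> P; apply: (concrete_explainable (x0 := a) concrete_P4) => //; first exact: p4_uniq P.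
case/and5P: P => ab bc cd /negPf ac /andP[/negPf ad /negPf bd].
by move=> [|[|[|[|i]]]] [|[|[|[|j]]]] //= _ _ _;
   rewrite ?ab ?bc ?cd ?ac ?ad ?bd // g_sym ?ab ?bc ?cd ?ac ?ad ?bd.
Qed.

Lemma bull_explainable a b c d v : p4 a b c d -> v \notin [:: a; b; c; d] ->
  g v b -> ~~ g v a -> explainable g [set x in [:: a; b; c; d; v]].
Proof.
move=> P vs vb /negPf va; have [vd vc _] := p4_attach P vs.
rewrite va in vd; rewrite vb in vc.
apply: (concrete_explainable (x0 := a) concrete_bull) => //.
  by rewrite -[_ :: _]/(rcons [:: a; b; c; d] v) rcons_uniq vs (p4_uniq P).
case/and5P: P => ab bc cd /negPf ac /andP[/negPf ad /negPf bd].
by move=> [|[|[|[|[|i]]]]] [|[|[|[|[|j]]]]] //= _ _ _;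
   rewrite ?ab ?bc ?cd ?ac ?ad ?bd ?va ?vb ?vc ?vd // g_sym ?ab ?bc ?cd ?ac ?ad ?bd ?va ?vb ?vc ?vd.
Qed.

(** Both [M] and the graph with [M] contracted, on [#|S| - #|M| + 1] vertices, are smaller than [S]
    and have at least two vertices. *)
Lemma module_explainable (S M : {set T}) :
  (forall S' : {set T}, #|S'| < #|S| -> 1 < #|S'| -> explainable g S') ->
  M \subset S -> 1 < #|M| < #|S| ->
  (forall x y z, x \in M -> y \in M -> z \in S :\: M -> g x z = g y z) ->
  explainable g S.
Proof.
move=> IH MS /andP[M2 Mlt] modM.
have [m mM] : exists m, m \in M by apply/card_gt0P; exact: ltnW M2.
apply: (explainable_subst g_sym MS mM) => [x y xM yS||]; first exact: modM.
  have cD : #|m |: (S :\: M)| = (#|S| - #|M|).+1.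
    by rewrite cardsU1 inE mM cardsDS.
  apply: IH; rewrite cD; last by rewrite ltnS subn_gt0.
  by rewrite -(ltn_add2r #|M|) addSn subnK ?(ltnW Mlt) // -addn1 ltn_add2l.
exact: IH.
Qed.

Lemma P4_reducible_explainable (S : {set T}) : 1 < #|S| -> explainable g S.
Proof.
have [n] := ubnP #|S|; elim: n S => // n IHn S Sn S2.
have IH (S' : {set T}) : #|S'| < #|S| -> 1 < #|S'| -> explainable g S'.
  by move=> S'S; apply: IHn; apply: leq_trans S'S _.
have reduce := module_explainable IH.
case: (eqVneq #|S| 2) => [/eqP/cards2P[x [y [xy ->]]]|S3].
  exact: pair_explainable.
have {S3}S3 : 2 < #|S| by rewrite ltn_neqAle eq_sym S3.
case: (boolP [exists a in S, exists b in S, exists c in S, exists d in S, p4 a b c d]); last first.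
  move=> free; have [|B [BS B0 [k Bk]]] := @p4_free_split S S2.
    move=> a b c d aS bS cS dS; apply: contra free => P.
    apply/exists_inP; exists a => //; apply/exists_inP; exists b => //.
    by apply/exists_inP; exists c => //; apply/exists_inP; exists d.
  have BlS := proper_card BS; have [BsS _] := andP BS.
  have cD : #|S :\: B| = #|S| - #|B| by rewrite cardsDS.
  (* A set [B] with two or more vertices is a module. If [B] is a single vertex, its complement is
     one, being joined uniformly to it. *)
  case: (ltnP 1 #|B|) => B1.
    apply: (reduce B) => //; first by rewrite B1.
    by move=> x y z xB yB zS; rewrite !Bk.
  have {}B1 : #|B| = 1 by apply/eqP; rewrite eqn_leq B1 card_gt0.
  apply: (reduce (S :\: B)); first exact: subsetDl.
    by rewrite cD B1 ltn_subRL S3 ltn_subrL (ltnW S2).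
  move=> x y z xB yB zS; rewrite !(g_sym _ z) !Bk //.
    by case/setDP: zS => zS; rewrite inE zS andbT negbK.
  by case/setDP: zS => zS; rewrite inE zS andbT negbK.
case/exists_inP=> a aS /exists_inP[b bS] /exists_inP[c cS] /exists_inP[d dS] P.
pose s := [:: a; b; c; d].
have sS x : x \in s -> x \in S by rewrite !inE => /or4P[] /eqP->.
pose M := [set x in S | [&& x \notin s, g x b & ~~ g x a]].
pose B := [set x in s] :|: M.
have BS : B \subset S.
  by apply/subsetP=> x /setUP[|/setIdP[]] //; rewrite inE; exact: sS.
have [/and5P[ab bc cd ac /andP[ad bd]] U] := (P, p4_uniq P).
have cs : #|[set x in s]| = 4.
  by rewrite cardsE (card_uniqP U).
have MB : M \subset B by exact: subsetUr.
case: (ltnP #|B| #|S|) => [BlS|SleB].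
  (* A vertex [z] outside [B] sees all or none of the path. If it disagreed on some [x] in [M], then
     [a - z - c - x] or [z - x - b - a] would be a second induced path through [a]. *)
  have Bz x z : x \in B -> z \in S :\: B -> g x z = g z a.
    move=> xB /setDP[zS]; rewrite in_setU negb_or inE => /andP[zs].
    rewrite inE zS zs /= negb_and negbK => zab; have [zd zc zi] := p4_attach P zs.
    have zb : g z b = g z a by apply/idP/idP => // zb; rewrite zb in zab.
    case/setUP: xB => [|/setIdP[xS /and3P[xs xb xa]]].
      by rewrite !inE => /or4P[] /eqP->; rewrite g_sym ?zd ?zc ?zb.
    have [xd xc _] := p4_attach P xs.
    have aP : a \in s by rewrite inE eqxx.
    case za: (g z a) zb zc zd => zb zc zd.
      apply: contraNT zs => xz.
      have P' : p4 a z c x.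
        by rewrite /p4 g_sym za zc zb (g_sym c) xc xb ac (g_sym a) xa (g_sym z) xz.
      by apply: (p4_same P P' aP); rewrite !inE eqxx ?orbT.
    apply: contraNF zs => xz.
    have P' : p4 z x b a.
      by rewrite /p4 g_sym xz xb (g_sym b) ab zb za xa.
    by apply: (p4_same P P' aP); rewrite !inE eqxx ?orbT.
  apply: (reduce B) => //.
    rewrite BlS andbT; apply: leq_trans (subset_leq_card (subsetUl _ _)).
    by rewrite cs.
  by move=> x y z xB yB zS; rewrite (Bz x z) ?(Bz y z).
have {BS SleB}SE : S = B by apply/esym/eqP; rewrite eqEcard BS.
(* Outside [M] only the path remains, and all of [M] sees it alike. The three cases are the P4, the
   module [M], and the bull. *)
case: (ltngtP #|M| 1) => [M0|M2|M1].
- have -> : S = [set x in s].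
    by rewrite SE /B (cards0_eq (A := M)) ?setU0 //; apply/eqP; rewrite -leqn0.
  exact: p4_explainable.
- apply: (reduce M).
  + by rewrite SE.
  + rewrite M2 (proper_card (_ : M \proper S)) //; apply/properP.
    by rewrite SE; split=> //; exists a; rewrite ?inE ?eqxx ?andbF.
  move=> x y z /setIdP[_ /and3P[xs xb xa]] /setIdP[_ /and3P[ys yb ya]].
  have [xd xc _] := p4_attach P xs; have [yd yc _] := p4_attach P ys.
  rewrite SE => /setDP[/setUP[|-> //]].
  rewrite !inE => /or4P[] /eqP-> _; rewrite ?xd ?yd ?xc ?yc ?xb ?yb //;
  by rewrite (negPf xa) (negPf ya).
have [v Mv] : exists v, M = [set v] by apply/cards1P; rewrite M1.
have : v \in M by rewrite Mv inE.
case/setIdP=> _ /and3P[vs vb va].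
have -> : S = [set x in [:: a; b; c; d; v]].
  by rewrite SE /B Mv; apply/setP=> x; rewrite !inE -!orbA.
exact: bull_explainable.
Qed.

End Graph.

(** * From explanations to labeled galled-trees *)

Lemma explainable_GaTEx (T : finType) (g : rel T) :
  irreflexive g -> 0 < #|T| -> explainable g [set: T] -> GaTEx g.
Proof.
move=> g_irr /card_gt0P[x0 _] [V [e [r [l [t E]]]]]; have N := expl_net E.
pose X := [set l x | x : T].
have lX x : l x \in X by exact: imset_f.
have XE v : (v \in X) = (outdeg e v == 0).
  suff -> : X = [set l x | x in [set: T]] by rewrite (expl_leaves E) inE.
  by apply/setP=> w; apply/imsetP/imsetP => -[x _ ->]; exists x.
have l_inj : injective l by move=> x y; apply: (expl_inj E); rewrite inE.
pose f x : {v : V | v \in X} := exist _ (l x) (lX x).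
(* The default [x0] is never returned, since every element of [X] is some [l x]. *)
pose f' (v : {v : V | v \in X}) := odflt x0 [pick x | l x == val v].
have fK : cancel f f'.
  move=> x; rewrite /f' /=; case: pickP => [y /eqP/l_inj //|/(_ x)].
  by rewrite eqxx.
have f'K : cancel f' f.
  case=> v vX; apply: val_inj; rewrite /f' /=; case: pickP => [y /eqP //|].
  by case/imsetP: (vX) => x _ -> /(_ x); rewrite eqxx.
exists V, e, X, (fun v => if v \in X then Lleaf else if t v then L1 else L0).
exists (fun v w => g (f' v) (f' w)); split.
- split; last by move=> v; case: ifP => //; case: (t v).
  split; [by apply/set0Pn; exists (l x0)|exact: net_acyclic N|right].
  have root0 : indeg e r = 0.
    apply/eqP; rewrite cards_eq0 -subset0; apply/subsetP=> u.
    by rewrite inE (negPf (net_root_source N u)).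
  exists r; split.
  + split=> //; first exact: net_root_out N.
    move=> v /eqP; rewrite cards_eq0 => /eqP v0.
    have src u : ~~ e u v by have := in_set0 u; rewrite -v0 inE => ->.
    by have := net_root_connect N v; rewrite (connect_source _ src) => /eqP.
  + move=> v; rewrite XE; split=> [/eqP v0|[-> //]].
    by split=> //; exact: network_leaf_indeg N v0.
  + move=> v; rewrite XE => /eqP v0 vr.
    by case: (net_degrees N vr) => [[]|[]|]; [|left|right].
  + move=> C /maxsetP[Cbi _] u v uC [u2 _] uN vC [v2 _] vN.
    exact: (net_galls N Cbi).
- move=> v w; rewrite -[v]f'K -[w]f'K; move: (f' v) (f' w) => {v w} x y.
  (* [explains] also covers equal leaves: such a leaf is its own lca, and both sides of the
     equivalence fail. *)
  rewrite !fK /=; case: (eqVneq x y) => [->|xy].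
    exists (l y); last by rewrite g_irr; split=> // -[].
    by apply: greatest_common_ancestor_lca; [exact: net_acyclic N|move=> u; rewrite andbb].
  have [v gv tv] := expl_lca E (in_setT x) (in_setT y) xy.
  exists v; first exact: greatest_common_ancestor_lca (net_acyclic N) gv.
  have vX : (v \in X) = false.
    apply/negP => /imsetP[z _ vz].
    have := greatest_common_ancestor_not_leaf E (in_setT x) (in_setT y) xy gv (in_setT z).
    by rewrite vz eqxx.
  rewrite vX tv; case: (g x y); last by split=> // -[].
  by split=> // _; split=> // -[] /l_inj xy'; rewrite xy' eqxx in xy.
- exists f; first by exists f'.
  by move=> x y; rewrite !fK.
Qed.

(** One vertex is explained by the one-vertex galled-tree, which [network] excludes by asking for a
    root of outdegree at least 2. *)
Lemma singleton_GaTEx (T : finType) (g : rel T) :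
  irreflexive g -> #|T| = 1 -> GaTEx g.
Proof.
move=> g_irr T1; have /cards1P[x Tx] : #|[set: T]| == 1 by rewrite cardsT T1.
have eqT (y z : T) : y = z.
  by have := in_setT y; have := in_setT z; rewrite Tx !inE => /eqP-> /eqP->.
pose f (y : T) : {y : T | y \in [set: T]} := exist _ y (in_setT y).
exists T, (fun _ _ => false), [set: T], (fun _ => Lleaf), (fun _ _ => false); split.
- split; last by move=> v; rewrite inE.
  split; first by apply/set0Pn; exists x; rewrite inE.
    by [].
  by left; split=> //; exists x.
- move=> y z; exists x.
    move=> w; split=> [_|_]; first exact: eqT.
    split; first by rewrite (eqT w (val y)) /common_ancestor (eqT (val z) (val y)) connect0.
    by move=> *; exact: eqT.
  by split=> // -[yz]; case: yz; apply: val_inj; exact: eqT.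
- exists f => [|y z]; last by rewrite (eqT z y) g_irr.
  by exists val => // -[y yT]; apply: val_inj.
Qed.

Theorem mainTheorem16 (T : finType) (g : rel T)
    (g_sym : symmetric g) (g_irr : irreflexive g) (T_nonempty : 0 < #|T|) :
  P4_reducible g -> GaTEx g.
Proof.
move=> g_red; case: (ltngtP #|T| 1) => [|T2|T1].
- by rewrite ltnNge T_nonempty.
- apply: explainable_GaTEx => //; apply: P4_reducible_explainable => //.
  by rewrite cardsT.
- exact: singleton_GaTEx.
Qed.
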